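(* Let $p$ be a basic zone tariff with an increasing price function $P:\mathbb{N}_{\ge 1}\to\mathbb{R}_{\ge 0}$, and consider the algorithm which, given two stations $x,y\in V$, returns a shortest $x$-$y$-path $W$ in the PTN with respect to the zone border weights $b(e)$, $e\in E$, as edge weights (computed by a shortest path algorithm). (i) The algorithm computes a cheapest path from $x$ to $y$, and hence a cheapest standard ticket $(W)$, in polynomial time. (ii) If $P(k)\le P(i)+P(k-i+1)$ for all $k\in\mathbb{N}_{\ge 1}$ and $i\in\{1,\dots,k\}$, then the algorithm yields a cheapest ticket from $x$ to $y$, namely $(W)$, in polynomial time.
   Context: ''Increasing'' means non-decreasing. A PTN is a finite, simple, connected, undirected graph $(V,E)$. A path is a finite sequence $(x_1,\dots,x_n)$, $n\ge 1$, of (not necessarily distinct) nodes with consecutive nodes adjacent; $\mathcal{W}$ is the set of all paths. A fare structure is a function $p:\mathcal{W}\to\mathbb{R}_{\ge 0}$. A zone partition $\mathcal{Z}$ is a partition of $V$ into nonempty sets called zones. The zone border weight of an edge $e=\{x,y\}$ is $b(e)=0$ if $x,y$ lie in the same zone and $b(e)=1$ otherwise. For a path $W=(x_1,\dots,x_n)$ put $z(W)=1+\sum_{i=1}^{n-1}b(x_i,x_{i+1})$. A fare structure $p$ is a basic zone tariff with respect to $P$ if $p(W)=P(z(W))$ for all $W\in\mathcal{W}$. A ticket of $W\in\mathcal{W}$ is a finite sequence of paths $T=(H_1,\dots,H_t)$ such that $W$ is a concatenation $W_1+\dots+W_t$ of subpaths with $W_j$ a subpath of $H_j$ for each $j$;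 its price is $\sum_{j=1}^t p(H_j)$. The standard ticket of $W$ is $(W)$. A cheapest ticket (resp. cheapest standard ticket) from $x$ to $y$ is one of minimum price among all tickets (resp. standard tickets) of all $x$-$y$-paths; a cheapest path from $x$ to $y$ is an $x$-$y$-path $W$ minimizing $p(W)$. *)

(* Defs.v *)
From HB Require Import structures.
From mathcomp Require Import all_boot all_order all_algebra.
From mathcomp Require Import reals.

Set Implicit Arguments.
Unset Strict Implicit.
Unset Printing Implicit Defensive.

Import Order.TTheory GRing.Theory Num.Theory.

(** * Public transportation networks, paths and zones *)

Record ptn := Ptn {
  station :> finType;
  adj : rel station;
  adj_sym : symmetric adj;
  adj_irrefl : irreflexive adj;
  adj_connected : forall x y, connect adj x y }.

(* Nodes may repeat; the one-node sequence is a path. *)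
Definition is_walk (G : ptn) (s : seq G) : bool :=
  if s is x :: s' then path (@adj G) x s' else false.

Definition walk (G : ptn) : Type := {s : seq G | is_walk s}.

Definition walk_from_to (G : ptn) (x y : G) (W : walk G) : bool :=
  (ohead (val W) == Some x) && (last x (val W) == y).

(* A zone partition is a [Z : {set {set G}}] with [partition Z [set: G]];
   [pblock Z x] is then the zone of [x]. *)
Definition border (G : ptn) (Z : {set {set G}}) (x y : G) : nat :=
  if pblock Z x == pblock Z y then 0 else 1.

(* [zip s (behead s)] lists the pairs of consecutive nodes of [s]. *)
Definition border_length (G : ptn) (Z : {set {set G}}) (W : walk G) : nat :=
  \sum_(e <- zip (val W) (behead (val W))) border Z e.1 e.2.

Definition zone_count (G : ptn) (Z : {set {set G}}) (W : walk G) : nat :=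
  1 + border_length Z W.

Definition shortest_path (G : ptn) (Z : {set {set G}}) (x y : G) (W : walk G)
    : Prop :=
  walk_from_to x y W /\
  forall W', walk_from_to x y W' -> border_length Z W <= border_length Z W'.

(** * Fares and tickets *)

Section Fares.
Local Open Scope ring_scope.
Variables (R : realType) (G : ptn).
Implicit Types (p : walk G -> R) (P : nat -> R) (W H : walk G)
  (T : seq (walk G)).

Definition fare_structure p : Prop := forall W, 0 <= p W.

(* Only the values of a price function at arguments [k >= 1] are
   constrained, and only these are used, since [zone_count] is positive. *)
Definition price_function P : Prop := forall k, (1 <= k)%N -> 0 <= P k.

Definition increasing P : Prop :=
  forall j k, (1 <= j)%N -> (j <= k)%N -> P j <= P k.

Definition basic_zone_tariff (Z : {set {set G}}) P p : Prop :=
  forall W, p W = P (zone_count Z W).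

(* Consecutive pieces share their junction node:
   (x_1..x_i) + (x_i..x_n) = (x_1..x_n). *)
Inductive concatenation : seq (seq G) -> seq G -> Prop :=
| Concat1 s : concatenation [:: s] s
| ConcatS s v s' ss : concatenation ss (v :: s') ->
    concatenation (rcons s v :: ss) (rcons s v ++ s').

Definition subpath (s : seq G) H : bool := is_walk s && infix s (val H).

Definition ticket W T : Prop :=
  exists2 ss : seq (seq G), concatenation ss (val W) & all2 subpath ss T.

Definition standard_ticket W T : Prop := T = [:: W].

Definition ticket_price p T : R := \sum_(H <- T) p H.

Definition cheapest_path p (x y : G) W : Prop :=
  walk_from_to x y W /\ forall W', walk_from_to x y W' -> p W <= p W'.

(* [tk W T] : [T] is a ticket of [W] of the kind under consideration. *)
Definition cheapest_of_kind (tk : walk G -> seq (walk G) -> Prop) p (x y : G) T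
    : Prop :=
  (exists2 W, walk_from_to x y W & tk W T) /\
  forall W' T', walk_from_to x y W' -> tk W' T' ->
    ticket_price p T <= ticket_price p T'.

Definition cheapest_ticket := cheapest_of_kind ticket.
Definition cheapest_standard_ticket := cheapest_of_kind standard_ticket.

End Fares.

(** * Machine model *)

(* A random access machine, programmed by structured commands.  The memory
   consists of arrays of natural numbers; a program names finitely many of
   them statically ([a] in [Get] and [Put]), while indices are computed.
   Every operation costs one unit.  Since there is addition and truncated
   subtraction but no multiplication, stored numbers gain at most a constant
   number of bits per step, so that uniform-cost polynomial time is Turing
   machine polynomial time. *)
Inductive expr :=
| Const of nat
| Get (a : nat) of expr
| Add of expr & expr
| Sub of expr & expr.

Inductive cmd :=
| Skip
| Put (a : nat) of expr & expr
| Emit of expr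
| Seq of cmd & cmd
| If of expr & cmd & cmd
| While of expr & cmd.

Definition store := nat -> nat -> nat.

Definition update (m : store) (a i v : nat) : store :=
  fun b j => if (b == a) && (j == i) then v else m b j.

Fixpoint eval (m : store) (e : expr) : nat :=
  match e with
  | Const c => c
  | Get a i => m a (eval m i)
  | Add e1 e2 => eval m e1 + eval m e2
  | Sub e1 e2 => eval m e1 - eval m e2
  end.

Fixpoint cost (e : expr) : nat :=
  match e with
  | Const _ => 1
  | Get _ i => (cost i).+1
  | Add e1 e2 | Sub e1 e2 => (cost e1 + cost e2).+1
  end.

(* [exec c m o m' o' t] : started with memory [m] and output [o], the command
   [c] halts after [t] steps with memory [m'] and output [o'].  A test
   succeeds when its value is nonzero. *)
Inductive exec : cmd -> store -> seq nat -> store -> seq nat -> nat -> Prop :=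
| ExecSkip m o : exec Skip m o m o 1
| ExecPut a i e m o :
    exec (Put a i e) m o (update m a (eval m i) (eval m e)) o
         (cost i + cost e).+1
| ExecEmit e m o : exec (Emit e) m o m (rcons o (eval m e)) (cost e).+1
| ExecSeq c1 c2 m o m1 o1 t1 m2 o2 t2 :
    exec c1 m o m1 o1 t1 -> exec c2 m1 o1 m2 o2 t2 ->
    exec (Seq c1 c2) m o m2 o2 (t1 + t2)
| ExecIfT e c1 c2 m o m' o' t :
    eval m e != 0 -> exec c1 m o m' o' t ->
    exec (If e c1 c2) m o m' o' (cost e + t).+1
| ExecIfF e c1 c2 m o m' o' t :
    eval m e == 0 -> exec c2 m o m' o' t ->
    exec (If e c1 c2) m o m' o' (cost e + t).+1
| ExecWhileF e c m o :
    eval m e == 0 -> exec (While e c) m o m o (cost e).+1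
| ExecWhileT e c m o m1 o1 t1 m2 o2 t2 :
    eval m e != 0 -> exec c m o m1 o1 t1 ->
    exec (While e c) m1 o1 m2 o2 t2 ->
    exec (While e c) m o m2 o2 (cost e + t1 + t2).+1.

(* A program has at most one result, so the results required to exist below
   are the results of the computation. *)
Lemma exec_det c m o m1 o1 t1 m2 o2 t2 :
  exec c m o m1 o1 t1 -> exec c m o m2 o2 t2 ->
  [/\ m1 = m2, o1 = o2 & t1 = t2].
Proof.
move=> H; elim: H m2 o2 t2 => {c m o m1 o1 t1};
  intros; match goal with H : exec _ _ _ ?m ?o ?t |- [/\ _ = ?m, _ = ?o & _ = ?t] =>
    inversion H; subst; clear H end;
  try match goal with
    nz : is_true (?n != 0), z : is_true (?n == 0) |- _ => by rewrite z in nz end;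
  repeat match goal with
    IH : forall m o t, exec ?c ?m0 ?o0 m o t -> _, H : exec ?c ?m0 ?o0 _ _ _ |- _ =>
      have [? ? ?] := IH _ _ _ H; subst; clear IH H end;
  by [].
Qed.

(** * Journey queries and polynomial-time algorithms answering them *)

Record query := Query {
  net : ptn;
  zones : {set {set net}};
  zones_partition : partition zones [set: net];
  origin : net;
  destination : net }.

Definition code (G : ptn) (v : G) : nat := enum_rank v.

(* The number of stations, the origin, the destination, the zone number of
   every station, and the adjacency matrix row by row. *)
Definition encode (I : query) : seq nat :=
  [:: #|net I|; code (origin I); code (destination I)]
  ++ [seq index (pblock (zones I) v) (enum (zones I)) | v <- enum (net I)]
  ++ [seq nat_of_bool (adj u v) | u <- enum (net I), v <- enum (net I)].

(* The input is in array 0; all other cells are 0. *)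
Definition load (w : seq nat) : store :=
  fun a i => if a == 0 then nth 0 w i else 0.

(* [A] halts on every query [I] within a number of steps polynomial in the
   size of the input, and emits the nodes of a path [W] with [spec I W]. *)
Definition computes_in_poly_time
    (A : cmd) (spec : forall I : query, walk (net I) -> Prop) : Prop :=
  exists q : {poly nat}, forall I : query,
    exists (W : walk (net I)) (m : store) (t : nat),
      [/\ exec A (load (encode I)) [::] m [seq code v | v <- val W] t,
          t <= (q.[size (encode I)])%R
        & spec I W].

Definition shortest_path_algorithm (A : cmd) : Prop :=
  computes_in_poly_time A
    (fun I W => shortest_path (zones I) (origin I) (destination I) W).

(* Main.v *)
Require Import Defs.
From HB Require Import structures.
From mathcomp Require Import all_boot all_order all_algebra.
From mathcomp Require Import reals.
From mathcomp Require Import zify.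

Set Implicit Arguments.
Unset Strict Implicit.
Unset Printing Implicit Defensive.

Import Order.TTheory GRing.Theory Num.Theory.

(** Under a basic zone tariff with an increasing price function the price of a
    path depends monotonically on its number of zone border crossings, so a
    path with fewest crossings is a cheapest path ([shortest_path_cheapest]).
    For tickets, the pieces of a path share only their junction nodes, hence
    their crossings add up to those of the path; since a zone count is one plus
    the crossings, the condition [P k <= P i + P (k - i + 1)] says precisely
    that splitting a path never makes it cheaper, and enlarging a piece does
    not either by monotonicity ([ticket_price_ge]).  These facts hold for every
    shortest path, whichever algorithm produced it, and the running time is
    untouched by replacing one property of the output by another.

    What remains is a program that finds a shortest path in polynomial time.
    It is a Bellman-Ford computation of labels, which are upper bounds on
    distances to the destination.  An arc is given the weight
    [n * border + 1], where [n] is the number of stations, rather than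
    [border].  A simple path has fewer than [n] arcs, so minimizing this weight
    minimizes crossings first and breaks ties by the number of arcs
    ([settled_shortest]).  The gain is that all weights are positive: along the
    stored successors the labels strictly decrease, so that following them
    cannot cycle, not even inside a zone, where the border weights vanish.

    Arcs are relaxed in rounds until a round changes nothing.  Then the labels
    satisfy the triangle inequality on every arc and vanish at the destination,
    so they are lower bounds on the weights of all paths
    ([settled_le_path]); on the other hand the path read off the successors
    weighs at most the label of the origin, hence it is optimal.  Every
    round that changes a label lowers the sum of the labels, which is at most
    [n ^ 3]; one round costs [O(n ^ 2)], and the input has more than [n ^ 2]
    entries, whence the cubic bound of [halts_shortest_path_cmd]. *)

(** * Border crossings of node sequences *)

Section Crossings.
Variables (G : ptn) (Z : {set {set G}}).
Implicit Types (s : seq G) (x y : G).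

Definition crossings s : nat :=
  \sum_(e <- zip s (behead s)) border Z e.1 e.2.

Lemma crossings1 x : crossings [:: x] = 0.
Proof. exact: big_nil. Qed.

Lemma crossings_cons2 x y s :
  crossings [:: x, y & s] = border Z x y + crossings (y :: s).
Proof. exact: big_cons. Qed.

Lemma crossings_junction s v s' :
  crossings (rcons s v ++ s') = crossings (rcons s v) + crossings (v :: s').
Proof.
elim: s => [|x [|y s] IHs] /=; first by rewrite crossings1.
- by rewrite !crossings_cons2 crossings1 addn0.
- by move: IHs => /= IHs; rewrite !crossings_cons2 IHs addnA.
Qed.

Lemma crossings_rcons x s y :
  crossings (x :: rcons s y) = crossings (x :: s) + border Z (last x s) y.
Proof.
elim: s x => [|z s IHs] x /=; first by rewrite crossings_cons2 !crossings1 addn0.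
by rewrite !crossings_cons2 IHs addnA.
Qed.

Lemma crossings_suffix s s' : crossings s' <= crossings (s ++ s').
Proof.
elim: s => // x s IHs; apply: leq_trans IHs _ => /=.
case: (s ++ s') => [|y r]; first by rewrite /crossings big_nil.
by rewrite crossings_cons2 leq_addl.
Qed.

Lemma crossings_infix s s' : infix s s' -> crossings s <= crossings s'.
Proof.
case/infixP=> r [r' ->]; apply: leq_trans (crossings_suffix r _).
case/lastP: s => [|s v]; first by rewrite /crossings big_nil.
by rewrite crossings_junction leq_addr.
Qed.

Lemma crossings_le_hops x s : crossings (x :: s) <= size s.
Proof.
elim: s x => [|y s IHs] x /=; first by rewrite crossings1.
rewrite crossings_cons2 -add1n leq_add //.
by rewrite /border; case: ifP.
Qed.

(** Cutting out the detour between two visits of a node never adds a crossing;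
    since all weights are nonnegative, only simple paths matter. *)
Lemma simple_path_crossings x s :
  path (@adj G) x s ->
  exists s', [/\ path (@adj G) x s', uniq (x :: s'), last x s' = last x s
                & crossings (x :: s') <= crossings (x :: s)].
Proof.
elim: s x => [|y s IHs] x; first by exists [::].
move=> /= /andP[xy /IHs[s' [pys' us' ls' cs']]].
(* If [x] comes back, restart from its later visit. *)
have [xs'|xs'] := boolP (x \in y :: s'); last first.
  exists (y :: s'); split; rewrite /= ?xy //; first by rewrite xs'.
  by rewrite !crossings_cons2 leq_add2l.
case/splitPl: xs' pys' us' ls' cs' => r r' rx; rewrite cat_path rx last_cat rx.
rewrite -cat_cons (lastI y r) rx cat_rcons => /andP[_ pxr'].
rewrite cat_uniq => /and3P[_ _ ur'] lr' cr'; exists r'; split=> //.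
apply: leq_trans (crossings_suffix (belast y r) _) (leq_trans cr' _).
by rewrite crossings_cons2 leq_addl.
Qed.

End Crossings.

(** * Tickets under a basic zone tariff *)

Section Tickets.
Local Open Scope ring_scope.
Variables (R : realType) (G : ptn) (Z : {set {set G}}).
Variables (P : nat -> R) (p : walk G -> R).
Hypotheses (P_incr : increasing P) (pP : basic_zone_tariff Z P p).

Lemma shortest_path_cheapest (x y : G) (W : walk G) :
  shortest_path Z x y W -> cheapest_path p x y W.
Proof.
by case=> xyW minW; split=> // W' /minW leW; rewrite !pP; apply: P_incr.
Qed.

Lemma cheapest_path_standard_ticket (x y : G) (W : walk G) :
  cheapest_path p x y W -> cheapest_standard_ticket p x y [:: W].
Proof.
case=> xyW minW; split=> [|W' _ xyW' ->]; first by exists W.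
by rewrite /ticket_price !big_seq1 minW.
Qed.

Hypothesis P_split : forall k i : nat, (1 <= k)%N -> (1 <= i)%N -> (i <= k)%N ->
  P k <= P i + P (k - i + 1)%N.

(** Consecutive pieces share only a node, so their crossings add up to those
    of the whole path; the zone counts thus add up to one too many per
    junction, which is exactly what the splitting condition on the price
    function absorbs.  Replacing a piece by a longer path of the ticket can
    only increase its price. *)
Lemma ticket_price_ge (W : walk G) T :
  ticket W T -> p W <= ticket_price p T.
Proof.
case=> ss; rewrite pP -[zone_count Z W]/(1 + crossings Z (val W))%N.
move: (val W) => w.
have piece s H : subpath s H -> P (1 + crossings Z s)%N <= p H.
  by case/andP=> _ sH; rewrite pP P_incr // leq_add2l crossings_infix.
move=> ssw; elim: {ss w} ssw T => [s|s v s' ss _ IHss] [|H T] //=.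
  by case/andP=> /piece sH; case: T => // _; rewrite /ticket_price big_seq1.
case/andP=> /piece sH /IHss ssT; rewrite /ticket_price big_cons.
apply: le_trans (lerD sH ssT); rewrite crossings_junction.
apply: le_trans (P_split (i := (1 + crossings Z (rcons s v))%N) _ _ _) _ => //.
  by rewrite leq_add2l leq_addr.
by rewrite addnA addKn [(_ + 1)%N]addnC.
Qed.

Lemma shortest_path_cheapest_ticket (x y : G) (W : walk G) :
  shortest_path Z x y W -> cheapest_ticket p x y [:: W].
Proof.
case/shortest_path_cheapest=> xyW minW; split.
  exists W => //; exists [:: val W]; first exact: Concat1.
  by rewrite /= /subpath (valP W) infix_refl.
move=> W' T' /minW leW /ticket_price_ge; apply: le_trans.
by rewrite /ticket_price big_seq1.
Qed.

End Tickets.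

(** * Total correctness within a time bound *)

(** The bound [b] is only an upper estimate, so that both branches of a test
    and all iterations of a loop can share one budget. *)
Definition halts_within (b : nat) (c : cmd) (m : store) (o : seq nat)
    (Q : store -> seq nat -> Prop) : Prop :=
  exists m' o' t, [/\ exec c m o m' o' t, t <= b & Q m' o'].

Section TimedRules.
Implicit Types (m : store) (o : seq nat) (Q : store -> seq nat -> Prop).

Lemma halts_mono b b' c m o Q Q' :
  halts_within b c m o Q -> b <= b' -> (forall m' o', Q m' o' -> Q' m' o') ->
  halts_within b' c m o Q'.
Proof.
case=> m' [o' [t [ct tb Qm']]] bb' QQ'; exists m', o', t.
by split=> //; [apply: leq_trans bb' | apply: QQ'].
Qed.

Lemma halts_skip b m o Q : 0 < b -> Q m o -> halts_within b Skip m o Q.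
Proof. by move=> b0 Qm; exists m, o, 1; split=> //; constructor. Qed.

Lemma halts_put b a i e m o Q :
  cost i + cost e < b -> Q (update m a (eval m i) (eval m e)) o ->
  halts_within b (Put a i e) m o Q.
Proof. by move=> ltb Qm; do 3!eexists; split; [constructor | |]. Qed.

Lemma halts_emit b e m o Q :
  cost e < b -> Q m (rcons o (eval m e)) -> halts_within b (Emit e) m o Q.
Proof. by move=> ltb Qm; do 3!eexists; split; [constructor | |]. Qed.

Lemma halts_seq b1 b2 b c1 c2 m o Q :
  b1 + b2 <= b ->
  halts_within b1 c1 m o (fun m' o' => halts_within b2 c2 m' o' Q) ->
  halts_within b (Seq c1 c2) m o Q.
Proof.
move=> leb [m1 [o1 [t1 [ct1 tb1 [m2 [o2 [t2 [ct2 tb2 Qm2]]]]]]]].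
exists m2, o2, (t1 + t2); split=> //; first exact: ExecSeq ct1 ct2.
by apply: leq_trans leb; apply: leq_add.
Qed.

Lemma halts_if b1 b e c1 c2 m o Q :
  cost e + b1 < b ->
  (eval m e != 0 -> halts_within b1 c1 m o Q) ->
  (eval m e == 0 -> halts_within b1 c2 m o Q) ->
  halts_within b (If e c1 c2) m o Q.
Proof.
move=> ltb run1 run2; have [e0|e0] := boolP (eval m e == 0).
- have [m' [o' [t [ct tb Qm']]]] := run2 e0; exists m', o', (cost e + t).+1.
  split=> //; first exact: ExecIfF.
  by apply: leq_trans ltb; rewrite ltnS leq_add2l.
- have [m' [o' [t [ct tb Qm']]]] := run1 e0; exists m', o', (cost e + t).+1.
  split=> //; first exact: ExecIfT.
  by apply: leq_trans ltb; rewrite ltnS leq_add2l.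
Qed.

(** One measure serves both purposes: its decrease proves termination, its
    initial value bounds the number of iterations. *)
Lemma halts_while (Inv : store -> seq nat -> Prop) (f : store -> nat) b e c m o :
  (forall m o, Inv m o -> eval m e != 0 ->
     halts_within b c m o (fun m' o' => Inv m' o' /\ f m' < f m)) ->
  Inv m o ->
  halts_within ((f m).+1 * (cost e + b).+1) (While e c) m o
    (fun m' o' => Inv m' o' /\ eval m' e = 0).
Proof.
move=> body; have [k] := ubnP (f m); elim: k => // k IHk in m o *.
rewrite ltnS => fk Im; have [e0|e0] := eqVneq (eval m e) 0.
  exists m, o, (cost e).+1; split=> //; first by apply: ExecWhileF; apply/eqP.
  by apply: leq_trans (leq_pmull _ _); rewrite // ltnS leq_addr.
have [m1 [o1 [t1 [ct1 tb1 [Im1 f1]]]]] := body _ _ Im e0.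
have [m2 [o2 [t2 [ct2 tb2 Qm2]]]] := IHk _ o1 (leq_trans f1 fk) Im1.
exists m2, o2, (cost e + t1 + t2).+1; split=> //.
  exact: ExecWhileT ct1 ct2.
rewrite mulSn -addSn leq_add //; first by rewrite ltnS leq_add2l.
by apply: leq_trans tb2 _; rewrite leq_mul2r f1 orbT.
Qed.

Definition reg (a : nat) : expr := Get a (Const 0).
Definition set_reg (a : nat) (e : expr) : cmd := Put a (Const 0) e.
Definition for_loop (x : nat) (e : expr) (c : cmd) : cmd :=
  Seq (set_reg x (Const 0))
      (While (Defs.Sub e (reg x)) (Seq c (set_reg x (Add (reg x) (Const 1))))).

(** The summands 3 and 10 cover the initialization of the counter and, in each
    iteration, the test and the increment. *)
Definition for_time (e : expr) (N b : nat) : nat :=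
  3 + N.+1 * (cost e + b + 10).

(** The invariant has to pin down the counter and the bound, which the body
    may not disturb; the step accounts for the increment that follows the
    body. *)
Lemma halts_for (Inv : nat -> store -> seq nat -> Prop) N b x e c m o :
  (forall i m o, Inv i m o -> m x 0 = i /\ eval m e = N) ->
  (forall i m o, i < N -> Inv i m o ->
     halts_within b c m o
       (fun m' o' => Inv i.+1 (update m' x 0 (m' x 0).+1) o')) ->
  Inv 0 (update m x 0 0) o ->
  halts_within (for_time e N b) (for_loop x e c) m o (Inv N).
Proof.
move=> InvE body Inv0; apply: halts_seq (leqnn _) _; apply: halts_put => //.
pose J m o := exists2 i, i <= N & Inv i m o.
have J0 : J (update m x 0 0) o by exists 0.
apply: halts_mono (halts_while (f := fun m => N - m x 0) (b := b + 6) _ J0) _ _.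
- move=> {J0 Inv0}m {}o [i iN Im] /= iN'.
  have [xi eN] := InvE _ _ _ Im; rewrite eN xi subn_eq0 -ltnNge in iN'.
  apply: halts_seq (leqnn _) _.
  apply: halts_mono (body _ _ _ iN' Im) (leqnn _) _.
  move=> m' o' Im'; apply: halts_put; rewrite //= addn1.
  split; first by exists i.+1.
  by have [-> _] := InvE _ _ _ Im'; rewrite xi subnS prednK // subn_gt0.
- rewrite leq_mul ?ltnS ?leq_subr //=; lia.
- move=> m' o' [[i iN Im']] /=; have [xi eN] := InvE _ _ _ Im'.
  rewrite eN xi => /eqP; rewrite subn_eq0 => Ni.
  by rewrite (@anti_leq N i) ?Ni ?iN.
Qed.

End TimedRules.

(** * The shortest path program *)

(* The two tables are indexed by station numbers; of each register only the
   cell 0 is used. *)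
Local Notation input := 0 (only parsing).
Local Notation label_tab := 1 (only parsing).
Local Notation next_tab := 2 (only parsing).
Local Notation tail_reg := 3 (only parsing).
Local Notation head_reg := 4 (only parsing).
Local Notation arc_reg := 5 (only parsing).
Local Notation changed_reg := 6 (only parsing).
Local Notation top_reg := 7 (only parsing).
Local Notation node_reg := 8 (only parsing).
Local Notation bid_reg := 9 (only parsing).

Definition stations_e : expr := Get input (Const 0).
Definition origin_e : expr := Get input (Const 1).
Definition destination_e : expr := Get input (Const 2).
Definition zone_e (v : expr) : expr := Get input (Add (Const 3) v).
(** Subtraction is truncated, so inequality takes both differences. *)
Definition distinct_e (a b : expr) : expr := Add (Defs.Sub a b) (Defs.Sub b a).

(** The initial label, [n * n], exceeds the weight of every simple path and
    thus plays the role of infinity; it is obtained by repeated addition, as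
    the machine cannot multiply. *)
Definition init_labels : cmd :=
  Seq (for_loop tail_reg stations_e
         (set_reg top_reg (Add (reg top_reg) stations_e)))
 (Seq (for_loop tail_reg stations_e
         (Put label_tab (reg tail_reg) (reg top_reg)))
 (Seq (Put label_tab destination_e (Const 0))
      (set_reg changed_reg (Const 1)))).

Definition relax_arc : cmd :=
  Seq (set_reg bid_reg (Add (Get label_tab (reg head_reg)) (Const 1)))
 (Seq (If (distinct_e (zone_e (reg tail_reg)) (zone_e (reg head_reg)))
          (set_reg bid_reg (Add (reg bid_reg) stations_e)) Skip)
 (Seq (If (Get input (reg arc_reg))
          (If (Defs.Sub (Get label_tab (reg tail_reg)) (reg bid_reg))
              (Seq (Put label_tab (reg tail_reg) (reg bid_reg))
              (Seq (Put next_tab (reg tail_reg) (reg head_reg))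
                   (set_reg changed_reg (Const 1))))
              Skip)
          Skip)
      (set_reg arc_reg (Add (reg arc_reg) (Const 1))))).

(** The arcs are visited in the order of the adjacency matrix, so that the
    matrix can be read by advancing a single pointer. *)
Definition relax_all : cmd :=
  Seq (set_reg changed_reg (Const 0))
 (Seq (set_reg arc_reg (Add (Const 3) stations_e))
      (for_loop tail_reg stations_e (for_loop head_reg stations_e relax_arc))).

Definition emit_route : cmd :=
  Seq (set_reg node_reg origin_e)
 (Seq (Emit (reg node_reg))
      (While (distinct_e (reg node_reg) destination_e)
         (Seq (set_reg node_reg (Get next_tab (reg node_reg)))
              (Emit (reg node_reg))))).

Definition shortest_path_cmd : cmd :=
  Seq init_labels (Seq (While (reg changed_reg) relax_all) emit_route).

Lemma eval_distinct m a b :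
  (eval m (distinct_e a b) == 0) = (eval m a == eval m b).
Proof. by rewrite /= addn_eq0 !subn_eq0 eqn_leq. Qed.

(** * Reading a query *)

Lemma nth_allpairs (S T U : Type) (f : S -> T -> U) s t x0 y0 z0 i j :
  i < size s -> j < size t ->
  nth z0 [seq f x y | x <- s, y <- t] (i * size t + j) =
  f (nth x0 s i) (nth y0 t j).
Proof.
elim: s i => // x s IHs [|i] /= si tj; rewrite nth_cat size_map.
  by rewrite tj (nth_map y0).
by rewrite mulSn -addnA ltnNge leq_addr addKn IHs.
Qed.

Section Query.
Variable I : query.
Local Notation G := (net I).
Local Notation Z := (zones I).
Implicit Types (x y : G) (m : store).

(** Folded, so that all occurrences of the cardinal agree syntactically. *)
Definition station_count : nat := #|net I|.
Local Notation n := station_count.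

Lemma code_lt x : code x < n. Proof. exact: ltn_ord. Qed.

Lemma code_inj : injective (@code G).
Proof. by move=> x y /val_inj/enum_rank_inj. Qed.

Lemma codeP i : i < n -> exists x, code x = i.
Proof. by move=> ni; exists (enum_val (Ordinal ni)); rewrite /code enum_valK. Qed.

Definition arc_index x y : nat := code x * n + code y.

Lemma arc_index_lt x y : arc_index x y < n * n.
Proof.
rewrite /arc_index; apply: (@leq_trans (code x * n + n)).
  by rewrite ltn_add2l code_lt.
by rewrite addnC -mulSn leq_mul2r code_lt orbT.
Qed.

Lemma arc_index_inj x y x' y' :
  arc_index x y = arc_index x' y' -> x = x' /\ y = y'.
Proof.
rewrite /arc_index => eqk; have n0 : 0 < n by apply: leq_trans (code_lt x).
have := congr1 (divn^~ n) eqk; have := congr1 (modn^~ n) eqk.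
rewrite /= !modnMDl !divnMDl // !modn_small ?divn_small ?code_lt // !addn0.
by move=> /code_inj -> /code_inj ->.
Qed.

Lemma size_encode : size (encode I) = 3 + n + n * n.
Proof. by rewrite /encode !size_cat size_map size_allpairs -cardE addnA. Qed.

Lemma encode_zone x :
  nth 0 (encode I) (3 + code x) = index (pblock Z x) (enum Z).
Proof.
rewrite /encode nth_cat ltnNge leq_addr addKn nth_cat size_map -cardE code_lt.
by rewrite (nth_map x) -?cardE ?code_lt // /code nth_enum_rank.
Qed.

Lemma encode_adj x y : nth 0 (encode I) (3 + n + arc_index x y) = adj x y.
Proof.
rewrite /encode -addnA nth_cat ltnNge leq_addr addKn nth_cat size_map -cardE.
rewrite ltnNge leq_addr addKn /arc_index.
rewrite /station_count; have -> := cardE G; rewrite (nth_allpairs _ x x) -?cardE ?code_lt //.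
by rewrite /code !nth_enum_rank.
Qed.

(** Zone numbers distinguish zones because the zones cover all stations. *)
Lemma eq_zone_code x y :
  (index (pblock Z x) (enum Z) == index (pblock Z y) (enum Z)) =
  (pblock Z x == pblock Z y).
Proof.
have zoneP z : pblock Z z \in enum Z.
  rewrite mem_enum pblock_mem //.
  by have /and3P[/eqP-> _ _] := zones_partition I; rewrite inE.
by apply/eqP/eqP=> [/(index_inj set0)-> | ->].
Qed.

(** * Labels *)

Definition arc_weight x y : nat := n * border Z x y + 1.
Definition label m x : nat := m label_tab (code x).

(** The invariant of the whole search.  A label below the initial value is
    justified by a successor; an inequality is enough there, and is all that
    survives when the label of the successor is lowered later. *)
Definition sound m : Prop :=
  [/\ m input =1 nth 0 (encode I), label m (destination I) = 0,
      forall x, label m x <= n * n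
    & forall x, x != destination I -> label m x < n * n ->
        exists y, [/\ m next_tab (code x) = code y, adj x y
                    & arc_weight x y + label m y <= label m x]].

Definition relaxed m x y : Prop :=
  adj x y -> label m x <= arc_weight x y + label m y.

Definition settled m : Prop := sound m /\ forall x y, relaxed m x y.

Definition total m : nat := \sum_x label m x.

Lemma total_decr m m' x :
  (forall z, label m' z <= label m z) -> label m' x < label m x ->
  total m' < total m.
Proof.
move=> le_m lt_x; rewrite /total (bigD1 x) //= [ltnRHS](bigD1 x) //=.
by rewrite -addSn leq_add // leq_sum.
Qed.

Section Improve.
Variables (m m' : store) (x y : G).
Hypotheses (sm : sound m) (xy : adj x y).
Hypothesis bid : arc_weight x y + label m y < label m x.
Hypothesis input' : m' input =1 m input.
Hypothesis label' : forall z,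
  label m' z = if z == x then arc_weight x y + label m y else label m z.
Hypothesis next' : forall z,
  m' next_tab (code z) = if z == x then code y else m next_tab (code z).

Lemma improve_le z : label m' z <= label m z.
Proof. by rewrite label'; case: eqP => // ->; apply: ltnW. Qed.

Lemma improve_total : total m' < total m.
Proof. by apply: (total_decr (x := x) improve_le); rewrite label' eqxx. Qed.

(** Lowering a label keeps the justifications of the others, whose right-hand
    sides can only decrease.  The destination is never affected, as its label
    is already 0. *)
Lemma improve_sound : sound m'.
Proof.
have [mI md mn mt] := sm; split=> [i||z|z zd].
- by rewrite input' mI.
- by apply/eqP; rewrite -leqn0 -md improve_le.
- exact: leq_trans (improve_le z) (mn z).
- rewrite label' next'; case: eqP => [-> _|_ /(mt z zd)[t [zt ztA le_t]]].
    by exists y; split=> //; rewrite leq_add2l improve_le.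
  by exists t; split=> //; apply: leq_trans le_t; rewrite leq_add2l improve_le.
Qed.

End Improve.

(** The triangle inequality on arcs telescopes: labels are potentials. *)
Lemma settled_le_path m x s :
  settled m -> path (@adj G) x s ->
  label m x <= n * crossings Z (x :: s) + size s + label m (last x s).
Proof.
case=> _ rm; elim: s x => [|y s IHs] x /=; first by rewrite leq_addl.
case/andP=> xy /IHs; rewrite crossings_cons2 => le_y.
apply: leq_trans (rm x y xy) _; rewrite /arc_weight mulnDr; lia.
Qed.

Lemma simple_path_hops x s : uniq (x :: s) -> size s < n.
Proof. by move/card_uniqP=> us; have := max_card (mem (x :: s)); rewrite us. Qed.

(** A simple path to the destination has at most [n - 1] arcs, each of weight
    at most [n + 1], and [(n - 1) * (n + 1) < n * n]: once all arcs are relaxed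
    no station keeps its initial label, so each one has a successor. *)
Lemma settled_lt_top m x : settled m -> label m x < n * n.
Proof.
move=> sm; have [[_ md _ _] _] := sm.
have /connectP[s xs ls] := adj_connected x (destination I).
have [s' [xs' us' ls' _]] := simple_path_crossings Z xs.
have := settled_le_path sm xs'; rewrite ls' -ls md addn0.
have := crossings_le_hops Z x s'; have := simple_path_hops us'.
move: (crossings Z _) (size s') (label m x) => c k l; nia.
Qed.

Lemma settled_next m x :
  settled m -> x != destination I ->
  exists y, [/\ m next_tab (code x) = code y, adj x y
              & arc_weight x y + label m y <= label m x].
Proof.
move=> sm xd; have [[_ _ _ mt] _] := sm.
exact: mt xd (settled_lt_top x sm).
Qed.

(** Here the weights [n * border + 1] are traded back for crossings: the
    competitor may be taken simple, so the number of its arcs, being less than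
    [n], cannot outweigh a single crossing. *)
Lemma settled_shortest m s s' :
  settled m ->
  n * crossings Z (origin I :: s) + size s <= label m (origin I) ->
  path (@adj G) (origin I) s' -> last (origin I) s' = destination I ->
  crossings Z (origin I :: s) <= crossings Z (origin I :: s').
Proof.
move=> sm le_s os' ls'; have [[_ md _ _] _] := sm.
have [t [ot ut lt ct]] := simple_path_crossings Z os'.
apply: leq_trans ct; have := settled_le_path sm ot.
rewrite lt ls' md addn0 => /(leq_trans le_s); have := simple_path_hops ut.
move: (crossings _ _) (crossings _ _) (size s) (size t) => c c' k k'; nia.
Qed.

(** * One round of relaxations *)

(** The state of a round that started with labels of sum [sum0], after [k] arcs:
    as long as no label has been improved the arcs seen so far are relaxed,
    and any improvement lowers the sum for good. *)
Definition round_state (sum0 k : nat) m : Prop :=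
  sound m /\
  ((m changed_reg 0 = 0 /\ total m <= sum0 /\
    forall x y, arc_index x y < k -> relaxed m x y) \/
   (m changed_reg 0 = 1 /\ total m < sum0)).

(** Extensionality in the arrays, as equal memories are only known to agree
    pointwise. *)
Lemma sound_ext m m' :
  (forall a i, a < 3 -> m' a i = m a i) -> sound m -> sound m'.
Proof.
move=> mm' [mI md mn mt].
have l z : label m' z = label m z by apply: mm'.
split=> [i||z|z]; rewrite ?mm' ?l //.
by move=> zd /(mt z zd)[t [zt ztA le_t]]; exists t; rewrite l.
Qed.

Lemma round_state_ext sum0 k m m' :
  (forall a i, a < 7 -> m' a i = m a i) -> round_state sum0 k m ->
  round_state sum0 k m'.
Proof.
move=> mm' [sm alt].
have l z : label m' z = label m z by apply: mm'.
have tot : total m' = total m by apply: eq_bigr => z _.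
split; first by apply: sound_ext sm => a i a3; apply: mm'; lia.
case: alt => [[mc [le_S rm]]|[mc lt_S]]; rewrite mm' // tot.
  by left; do 2!split=> //; move=> x y /rm; rewrite /relaxed !l.
by right.
Qed.

Lemma round_state_relaxed sum0 x y m :
  relaxed m x y -> round_state sum0 (arc_index x y) m ->
  round_state sum0 (arc_index x y).+1 m.
Proof.
move=> rxy [sm alt]; split=> //; case: alt => [[mc [le_S rm]]|]; last by right.
left; do 2!split=> //; move=> x' y'; rewrite ltnS leq_eqVlt.
by case/predU1P=> [/arc_index_inj[-> ->]//|]; apply: rm.
Qed.

Definition at_arc (k : nat) x y m : Prop :=
  [/\ m tail_reg 0 = code x, m head_reg 0 = code y & m arc_reg 0 = 3 + n + k].

Lemma halts_relax sum0 x y m o :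
  at_arc (arc_index x y) x y m -> round_state sum0 (arc_index x y) m ->
  halts_within 100 relax_arc m o (fun m' o' =>
    [/\ o' = o, at_arc (arc_index x y).+1 x y m'
      & round_state sum0 (arc_index x y).+1 m']).
Proof.
move=> atm rs; have [mx my mk] := atm; have [[mI _ _ _] _] := rs.
apply: (@halts_seq 10 90) => //; apply: halts_put => //=.
(* The state in which the two branches of the zone test meet. *)
pose bid_state m' (o' : seq nat) := [/\ o' = o,
  m' bid_reg 0 = arc_weight x y + label m' y
  & forall a i, a < 9 -> m' a i = m a i].
apply: (@halts_seq 34 56) => //.
apply: (halts_mono (b := 34) (Q := bid_state)) => //.
  apply: (@halts_if 10) => //; rewrite eval_distinct /update /= !mI mx my;
    rewrite !encode_zone eq_zone_code => xyZ.
    apply: halts_put => //=; split=> // [|a i a9]; last first.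
      by rewrite /update !(ltn_eqF a9).
    rewrite /update /label /= mI /arc_weight /border (negPf xyZ).
    by rewrite muln1 -addnA addnC [1 + _]addnC.
  apply: halts_skip => //; split=> // [|a i a9]; last by rewrite (ltn_eqF a9).
  by rewrite /label /= /arc_weight /border xyZ muln0 addnC.
move=> {}m1 {}_ [-> bid m1E].
have rs1 : round_state sum0 (arc_index x y) m1.
  by apply: round_state_ext rs => a i a7; apply: m1E; lia.
have {mx my mk} [m1x m1y m1k] : at_arc (arc_index x y) x y m1.
  by split; rewrite m1E.
apply: (@halts_seq 49 7) => //.
apply: (halts_mono (b := 49) (Q := fun m' o' => [/\ o' = o,
  at_arc (arc_index x y) x y m' & round_state sum0 (arc_index x y).+1 m'])) => //;
  last first.
  move=> m' _ [-> [m'x m'y m'k] rs']; apply: halts_put => //=; split=> //.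
    by split=> //; rewrite /update /= m'k addn1 -addnS.
have [sm1 alt1] := rs1; have [m1I _ _ _] := sm1.
(* Without an arc, or with a bid that is too high, nothing is written. *)
have skip : relaxed m1 x y -> halts_within 10 Skip m1 o (fun m' o' => [/\ o' = o,
    at_arc (arc_index x y) x y m' & round_state sum0 (arc_index x y).+1 m']).
  by move=> rxy; apply: halts_skip => //; split=> //; apply: round_state_relaxed.
apply: (@halts_if 40) => //=; rewrite m1k m1I encode_adj => xy; last first.
  by apply: halts_mono (skip _) _ _ => //; rewrite /relaxed; case: adj xy.
apply: (@halts_if 30) => //=; rewrite m1x bid subn_eq0 => better; last first.
  exact: halts_mono (skip _) _ _.
rewrite -ltnNge in better.
apply: (@halts_seq 8 20) => //; apply: halts_put => //=.
apply: (@halts_seq 8 8) => //; apply: halts_put => //=; apply: halts_put => //=.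
set m2 := update _ changed_reg 0 1.
have l2 z : label m2 z = if z == x then arc_weight x y + label m1 y
                         else label m1 z.
  by rewrite /label /m2 /update /= m1x bid (inj_eq (@code_inj)).
have n2 z : m2 next_tab (code z) = if z == x then code y
                                   else m1 next_tab (code z).
  by rewrite /m2 /update /= m1x m1y (inj_eq (@code_inj)).
have xyA : adj x y by case: adj xy.
split=> //; split; first exact: improve_sound sm1 xyA better _ l2 n2.
right; split=> //; apply: leq_trans (improve_total better l2) _.
by case: alt1 => [[_ []]|[_ /ltnW]].
Qed.

Lemma halts_relax_all m :
  sound m ->
  halts_within (10 + (20 + for_time stations_e n (for_time stations_e n 100)))
    relax_all m [::] (fun m' o' => o' = [::] /\ round_state (total m) (n * n) m').
Proof.
move=> sm; have [mI _ _ _] := sm.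
apply: halts_seq (leqnn _) _; apply: halts_put => //=.
apply: halts_seq (leqnn _) _; apply: halts_put => //=; rewrite /update /= mI.
set m1 := (fun b j : nat => _).
pose row_state i m' (o' : seq nat) := [/\ o' = [::], m' tail_reg 0 = i,
  m' arc_reg 0 = 3 + n + i * n & round_state (total m) (i * n) m'].
pose cell_state i j m' (o' : seq nat) := [/\ o' = [::], m' tail_reg 0 = i,
  m' head_reg 0 = j, m' arc_reg 0 = 3 + n + (i * n + j)
  & round_state (total m) (i * n + j) m'].
apply: halts_mono (halts_for (Inv := row_state) (N := n) _ _ _) _ _ => //.
- by move=> i m' o' [_ mi _ [[m'I _ _ _] _]]; rewrite /= m'I.
- move=> i m' o' /codeP[x <-] [-> mx mk rs].
  apply: halts_mono (halts_for (Inv := cell_state (code x)) (N := n) _ _ _)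
    (leqnn _) _.
  + by move=> j m2 o2 [_ _ mj _ [[m'I _ _ _] _]]; rewrite /= m'I.
  + move=> j m2 o2 /codeP[y <-] [-> m2x m2y m2k rs2].
    have at2 : at_arc (arc_index x y) x y m2 by split.
    apply: halts_mono (halts_relax [::] at2 rs2) (leqnn _) _.
    move=> m3 o3 [-> [m3x m3y m3k] rs3].
    by split=> //; rewrite /= ?m3y // addnS.
  + by split=> //; rewrite /= ?addn0.
  + move=> m2 o2 [-> m2x _ m2k rs2]; rewrite m2x.
    by split=> //; rewrite ?mulSnr.
- split=> //; first by rewrite /m1 /= addn0.
  by split=> //; left; do 2!split=> //.
- by move=> m' o' [-> _ _ rs].
Qed.

(** * Initialization, termination and output *)

Lemma total_le m : sound m -> total m <= n * (n * n).
Proof.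
case=> _ _ mn _; rewrite -[n * (n * n)]sum_nat_const.
by apply: leq_sum => x _.
Qed.

Lemma halts_init :
  halts_within (for_time stations_e n 20 + (for_time stations_e n 20 + 20))
    init_labels (load (encode I)) [::] (fun m o =>
    [/\ o = [::], sound m & m changed_reg 0 = 1]).
Proof.
apply: halts_seq (leqnn _) _.
apply: halts_mono (halts_for (N := n) (Inv := fun i m o =>
  [/\ o = [::], m tail_reg 0 = i, m top_reg 0 = i * n
    & m input =1 nth 0 (encode I)]) _ _ _) (leqnn _) _ => //.
- by move=> i m o [_ mi _ mI]; rewrite /= mI.
- move=> i m o _ [-> mi mt mI]; apply: halts_put => //=.
  by split=> //; rewrite /update /= ?mi // mt mI mulSnr.
move=> m _ [-> _ mt mI]; apply: halts_seq (leqnn _) _.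
apply: halts_mono (halts_for (N := n) (Inv := fun i m o =>
  [/\ o = [::], m tail_reg 0 = i, m top_reg 0 = n * n, m input =1 nth 0 (encode I)
    & forall x, code x < i -> label m x = n * n]) _ _ _) (leqnn _) _ => //.
- by move=> i m' o [_ mi _ mI' _]; rewrite /= mI'.
- move=> i m' o _ [-> mi mt' mI' ml]; apply: halts_put => //=.
  rewrite /label /update /= mi; split=> // x; rewrite ltnS leq_eqVlt.
  by case: eqP => //= _ /ml.
move=> {mt mI}m _ [-> _ mt mI ml].
apply: (@halts_seq 10 10) => //; apply: halts_put => //=; rewrite mI.
apply: halts_put => //=; set m' := update _ _ _ _.
have l' x : label m' x = if x == destination I then 0 else n * n.
  rewrite /label /m' /update /=.
  by rewrite (inj_eq (@code_inj)); case: eqP => // _; apply: ml; apply: code_lt.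
split=> //; split=> // [|x|x /negPf xd]; rewrite l' ?eqxx //.
  by case: eqP.
by rewrite xd ltnn.
Qed.

Definition round_time : nat :=
  10 + (20 + for_time stations_e n (for_time stations_e n 100)).

(** Rounds continue only while the sum of the labels drops, so its initial
    value bounds their number. *)
Lemma halts_rounds m :
  sound m -> m changed_reg 0 = 1 ->
  halts_within ((n * (n * n) + 2) * (round_time + 3))
    (While (reg changed_reg) relax_all) m [::]
    (fun m' o' => o' = [::] /\ settled m').
Proof.
move=> sm mc.
pose Inv m' (o' : seq nat) := [/\ o' = [::], sound m'
  & m' changed_reg 0 = 0 -> forall x y, relaxed m' x y].
have Inv0 : Inv m [::] by split=> //; rewrite mc.
(* The flag must enter the measure: the last round leaves the sum unchanged
   and only resets the flag. *)
pose f m' := total m' + m' changed_reg 0.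
apply: halts_mono (halts_while (f := f) (b := round_time) _ Inv0) _ _.
- move=> m1 _ [-> sm1 _] /= c1.
  apply: halts_mono (halts_relax_all sm1) (leqnn _) _ => m2 _ [-> [sm2 alt]].
  rewrite /f; split; last by case: alt => [[-> [+ _]]|[-> +]]; lia.
  split=> //; case: alt => [[_ [_ rm]] _ x y|[-> //]].
  by apply: rm; apply: arc_index_lt.
- by rewrite leq_mul //= ?addn3 // /f mc addn1 addn2 !ltnS total_le.
- by move=> m' o' [[-> sm' rm] /= c0]; split=> //; split=> //; apply: rm.
Qed.

(** The weight of the part already emitted plus the current label never exceeds
    the label of the origin, and the current label strictly decreases because
    arc weights are positive. *)
Lemma halts_emit_route m :
  settled m ->
  halts_within (10 + (10 + (n * n).+1 * 40)) emit_route m [::] (fun _ o' =>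
    exists s, [/\ o' = [seq code v | v <- origin I :: s],
      path (@adj G) (origin I) s, last (origin I) s = destination I
    & n * crossings Z (origin I :: s) + size s <= label m (origin I)]).
Proof.
move=> sm; have [[mI md mn _] _] := sm.
apply: halts_seq (leqnn _) _; apply: halts_put => //=.
apply: halts_seq (leqnn _) _; apply: halts_emit => //=.
rewrite /update /= mI -[nth _ _ _]/(code (origin I)).
pose Inv m' o' := (forall a i, a < 3 -> m' a i = m a i) /\
  exists s, [/\ o' = [seq code v | v <- origin I :: s],
    path (@adj G) (origin I) s, m' node_reg 0 = code (last (origin I) s)
    & n * crossings Z (origin I :: s) + size s + label m (last (origin I) s)
      <= label m (origin I)].
set m1 := (fun b j : nat => _).
have Inv1 : Inv m1 [:: code (origin I)].
  split=> [a i a3|]; first by rewrite /m1 (ltn_eqF (ltn_trans a3 _)).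
  by exists [::]; rewrite crossings1 muln0.
pose f m' := m' label_tab (m' node_reg 0).
apply: halts_mono (halts_while (f := f) (b := 20) _ Inv1) _ _.
- move=> m2 _ [m2E [s [-> os m2s le_s]]]; rewrite eval_distinct /= m2s m2E // mI.
  rewrite -[nth _ _ _]/(code (destination I)) (inj_eq (@code_inj)) => sd.
  have [y [ny sy le_y]] := settled_next sm sd.
  apply: (@halts_seq 10 10) => //; apply: halts_put => //=.
  apply: halts_emit => //=; rewrite /update /= m2s m2E // ny.
  split; last first.
    rewrite /f /= m2s !m2E // -!/(label m _); apply: leq_trans le_y.
    by rewrite /arc_weight addn1 addSn ltnS leq_addl.
  split=> [a i a3|]; first by rewrite m2E // (ltn_eqF (ltn_trans a3 _)).
  exists (rcons s y); rewrite last_rcons rcons_path os sy size_rcons.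
  split=> //; first by rewrite /= map_rcons.
  apply: leq_trans le_s; rewrite crossings_rcons mulnDr.
  by rewrite /arc_weight in le_y; lia.
- by rewrite leq_mul // ltnS /f /m1 /= -/(label m _) mn.
- move=> m' o' [[m'E [s [-> os m's le_s]]] /eqP]; rewrite eval_distinct /= m's.
  rewrite m'E // mI -[nth _ _ _]/(code (destination I)) (inj_eq (@code_inj)).
  by move=> /eqP sd; exists s; rewrite sd md addn0 in le_s; split.
Qed.

Lemma halts_shortest_path_cmd :
  halts_within (500 * size (encode I) ^ 3) shortest_path_cmd
    (load (encode I)) [::] (fun _ o =>
    exists2 W : walk (net I), o = [seq code v | v <- val W]
      & shortest_path Z (origin I) (destination I) W).
Proof.
pose rounds_time := (n * (n * n) + 2) * (round_time + 3).
pose emit_time := 10 + (10 + (n * n).+1 * 40).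
apply: (halts_seq (b2 := rounds_time + emit_time)); last first.
- apply: halts_mono halts_init (leqnn _) _ => m _ [-> sm mc].
  apply: halts_seq (leqnn _) _.
  apply: halts_mono (halts_rounds sm mc) (leqnn _) _ => {sm mc}m _ [-> sm].
  apply: halts_mono (halts_emit_route sm) (leqnn _) _ => m' o.
  move=> [s [-> os sd le_s]]; pose W : walk G := exist _ (origin I :: s) os.
  exists W => //; split; first by rewrite /walk_from_to /= eqxx sd eqxx.
  case=> [[//|x s'] xs'] /andP[/= /eqP[xo] /eqP s'd]; subst x.
  exact: settled_shortest sm le_s xs' s'd.
- rewrite size_encode /rounds_time /emit_time /round_time /for_time.
  have -> : cost stations_e = 2 by []; set s := 3 + n + n * n.
  (* [s] is the input size; the number of rounds is at most its square, and the
     cost of a round linear in it. *)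
  have s1 : 1 <= s by [].
  have kk : n.+1 * n.+1 <= 2 * s by rewrite /s; nia.
  have kkk : n * (n * n) + 2 <= s * s by rewrite /s; nia.
  have k1 : n.+1 <= s by rewrite /s; nia.
  have sss : s <= s ^ 3 by rewrite -{1}(expn1 s) leq_pexp2l.
  have round : 10 + (20 + (3 + n.+1 * (2 + (3 + n.+1 * (2 + 100 + 10)) + 10))) + 3
               <= 300 * s by nia.
  have := leq_mul kkk round.
  have -> : s * s * (300 * s) = 300 * s ^ 3 by rewrite !expnS expn0; nia.
  have nn : n * n <= s by rewrite /s leq_addl.
  lia.
Qed.

End Query.

Lemma shortest_path_cmd_correct : shortest_path_algorithm shortest_path_cmd.
Proof.
exists (500%:P * 'X^3)%R => I.
have [m [o [t [exec_t le_t [W oE shW]]]]] := halts_shortest_path_cmd I.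
exists W, m, t; split=> //; first by rewrite -oE.
apply: leq_trans le_t _; by rewrite hornerM hornerC hornerXn.
Qed.

Lemma poly_time_weaken A (spec spec' : forall I : query, walk (net I) -> Prop) :
  (forall I W, spec I W -> spec' I W) ->
  computes_in_poly_time A spec -> computes_in_poly_time A spec'.
Proof.
move=> ss' [q Aq]; exists q => I; have [W [m [t [exec_t le_t sW]]]] := Aq I.
by exists W, m, t; split=> //; apply: ss'.
Qed.

(** * Cheapest paths and cheapest tickets *)

Local Open Scope ring_scope.

Theorem corollary23 (R : realType) :
  (exists A : cmd, shortest_path_algorithm A) /\
  forall A : cmd, shortest_path_algorithm A ->
    computes_in_poly_time A (fun (I : query) (W : walk (net I)) =>
      forall (P : nat -> R) (p : walk (net I) -> R),
        price_function P -> increasing P ->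
        fare_structure p -> basic_zone_tariff (zones I) P p ->
        cheapest_path p (origin I) (destination I) W /\
        cheapest_standard_ticket p (origin I) (destination I) [:: W])
    /\
    computes_in_poly_time A (fun (I : query) (W : walk (net I)) =>
      forall (P : nat -> R) (p : walk (net I) -> R),
        price_function P -> increasing P ->
        fare_structure p -> basic_zone_tariff (zones I) P p ->
        (forall k i : nat, (1 <= k)%N -> (1 <= i)%N -> (i <= k)%N ->
           P k <= P i + P (k - i + 1)%N) ->
        cheapest_ticket p (origin I) (destination I) [:: W]).
Proof.
split; first by exists shortest_path_cmd; apply: shortest_path_cmd_correct.
move=> A shA; split; apply: poly_time_weaken shA => I W shW P p _ incrP _ pP.
- have minW := shortest_path_cheapest incrP pP shW.
  by split=> //; apply: cheapest_path_standard_ticket.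
- by move=> splitP; apply: shortest_path_cheapest_ticket incrP pP splitP _ _ _ shW.
Qed.
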